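(* For a ground vehicle at horizontal distance $r>0$ from the typical UAV, the blockage-aware detection probability under directional sensing is $$P_{\mathrm d}(r)=\frac{\gamma}{2\pi}\;p_{\mathsf L}(r,H)\;\exp\!\left(-\frac{\tau_{\mathrm s}(4\pi)^3 d^{2\alpha}N_0\,e^{2\kappa_f d}}{P_{\mathrm t}\,G_{\mathrm s}^2(\gamma)\,\lambda_c^2\,\bar\sigma}\right),\qquad d=\sqrt{r^2+H^2}.$$
   Context: Constants: UAV altitude $H>0$, beamwidth $\gamma\in(0,2\pi]$, transmit power $P_{\mathrm t}>0$, carrier wavelength $\lambda_c>0$, noise power $N_0>0$, path-loss exponent $\alpha>0$, absorption coefficient $\kappa_f>0$, sensing threshold $\tau_{\mathrm s}>0$, mean radar cross section $\bar\sigma>0$, main-lobe gain $G_{\mathrm s}(\gamma)=2\pi/(3\gamma)$, blockage parameters $a,b>0$. The line-of-sight (LoS) probability is $$p_{\mathsf L}(r,H)=\frac{1}{1+a\exp\!\left(-b\left[\frac{180}{\pi}\arctan(H/r)-a\right]\right)}.$$ The typical UAV is above the origin. The vehicle is at $(r,\theta)$ in polar coordinates. The angle $\theta$ is uniform on $[0,2\pi)$ relative to the boresight direction $\Theta_{\mathrm o}$ of the UAV. The effective gain is $G_{\mathrm{eff}}=G_{\mathrm s}(\gamma)$ if $|\theta-\Theta_{\mathrm o}|\le\gamma/2$ (angular difference modulo $2\pi$, taken in $(-\pi,\pi]$) and $G_{\mathrm{eff}}=0$ otherwise. The radar cross section $\sigma$ is exponentially distributed with mean $\bar\sigma$ (Swerling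 I). The link is LoS with probability $p_{\mathsf L}(r,H)$. The radar cross section, the LoS state and the angular position relative to the boresight are mutually independent. The sensing signal-to-noise ratio is $$\mathrm{SNR}_{\mathrm s}=\frac{P_{\mathrm t}G_{\mathrm{eff}}^2\lambda_c^2\sigma}{(4\pi)^3d^{2\alpha}N_0}\,e^{-2\kappa_f d},\qquad d=\sqrt{r^2+H^2}.$$ The vehicle is detected if the link is LoS and $\mathrm{SNR}_{\mathrm s}\ge\tau_{\mathrm s}$; $P_{\mathrm d}(r)$ is the probability of this event. *)

(* Defs.v *)
(* MathComp-Analysis: all quantities live in an arbitrary [R : realType]. *)
From mathcomp Require Import all_boot all_order all_algebra.
From mathcomp Require Import all_classical all_reals all_analysis.

Set Implicit Arguments.
Unset Strict Implicit.
Unset Printing Implicit Defensive.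

Import Order.TTheory GRing.Theory Num.Theory.
Import numFieldNormedType.Exports.

Local Open Scope classical_set_scope.
Local Open Scope ring_scope.

Section probability_notions.
Context d (T : measurableType d) (R : realType) (P : probability T R).

(* Only measurable sets are tested: neither side is meaningful elsewhere. *)
Definition has_law d' (T' : measurableType d') (X : T -> T')
    (Q : set T' -> \bar R) : Prop :=
  forall U : set T', measurable U -> P (X @^-1` U) = Q U.

(* Taking some of [A], [B], [C] to be [setT] gives the product rule for the
   sub-families. *)
Definition mutually_independent3 d1 d2 d3 (T1 : measurableType d1)
    (T2 : measurableType d2) (T3 : measurableType d3)
    (X : T -> T1) (Y : T -> T2) (Z : T -> T3) : Prop :=
  forall (A : set T1) (B : set T2) (C : set T3),
    measurable A -> measurable B -> measurable C ->
    P (X @^-1` A `&` Y @^-1` B `&` Z @^-1` C) =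
    (P (X @^-1` A) * P (Y @^-1` B) * P (Z @^-1` C))%E.

End probability_notions.

Section sensing_model.
Context {R : realType}.

Lemma two_pi_gt0 : 0 < 2 * pi :> R.
Proof. by rewrite mulr_gt0 ?ltr0n ?pi_gt0. Qed.

(* The representative of [x] modulo 2 pi in [0, 2 pi). *)
Definition angle_0_2pi (x : R) : R :=
  x - 2 * pi * (Num.floor (x / (2 * pi)))%:~R.

(* The representative of [x] modulo 2 pi in (-pi, pi]. *)
Definition angle_Npi_pi (x : R) : R :=
  x - 2 * pi * (Num.ceil ((x - pi) / (2 * pi)))%:~R.

(* [uniform_prob] is the uniform law on the closed interval; as a measure it is
   the uniform law on [0, 2 pi). *)
Definition uniform_angle : set R -> \bar R := uniform_prob two_pi_gt0.

(* The library parametrizes the exponential law by its rate. *)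
Definition exponential_of_mean (m : R) : set R -> \bar R :=
  exponential_prob m^-1.

Definition los_probability (a b r H : R) : R :=
  1 / (1 + a * expR (- b * (180 / pi * atan (H / r) - a))).

Definition distance3d (r H : R) : R := Num.sqrt (r ^+ 2 + H ^+ 2).

Definition mainlobe_gain (gamma : R) : R := 2 * pi / (3 * gamma).

Definition effective_gain (gamma theta Theta_o : R) : R :=
  if `|angle_Npi_pi (theta - Theta_o)| <= gamma / 2
  then mainlobe_gain gamma else 0.

Definition sensing_snr (P_t lambda_c N_0 alpha kappa_f r H G sigma : R) : R :=
  let d := distance3d r H in
  P_t * G ^+ 2 * lambda_c ^+ 2 * sigma
    / ((4 * pi) ^+ 3 * d `^ (2 * alpha) * N_0)
  * expR (- 2 * kappa_f * d).

(* [theta], [Theta_o], [sigma] and [los] are the random vehicle angle, boresight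
   direction, radar cross section and LoS state; [r] is deterministic. *)
Definition detection_event (T : Type)
    (H gamma P_t lambda_c N_0 alpha kappa_f tau_s r : R)
    (theta Theta_o sigma : T -> R) (los : T -> bool) : set T :=
  [set w | los w /\
     tau_s <= sensing_snr P_t lambda_c N_0 alpha kappa_f r H
                (effective_gain gamma (theta w) (Theta_o w)) (sigma w)].

End sensing_model.

(* Main.v *)
(* Reduced modulo 2 pi, the angle to the boresight misses the main lobe exactly
   when it lies in ]gamma/2, 2 pi - gamma/2[. A zero gain makes the SNR vanish,
   below the positive threshold; inside the main lobe the SNR is linear in the
   radar cross section, so detection is a rectangle event in the cross section,
   the LoS state and the angle, and its probability factors by independence. *)
Require Import Defs.
From mathcomp Require Import all_boot all_order all_algebra.
From mathcomp Require Import all_classical all_reals all_analysis.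
From mathcomp Require Import zify ring lra.

Set Implicit Arguments.
Unset Strict Implicit.
Unset Printing Implicit Defensive.

Import Order.TTheory GRing.Theory Num.Theory.
Import numFieldNormedType.Exports.

Local Open Scope classical_set_scope.
Local Open Scope ring_scope.

(** The fundamental theorem of calculus on an unbounded interval applies to the antiderivative
    [- expR (- rate * z)], which tends to 0 at infinity. *)
Lemma exponential_prob_itvcy (R : realType) (rate x : R) :
  0 < rate -> 0 <= x ->
  exponential_prob rate `[x, +oo[ = (expR (- rate * x))%:E.
Proof.
move=> rate_gt0 x_ge0.
have cexp : continuous (fun z : R => expR (- rate * z)).
  move=> z; apply: continuous_comp; last exact: continuous_expR.
  exact: mulrl_continuous.
rewrite /exponential_prob (@ge0_continuous_FTC2y _ _
  (fun z => - expR (- rate * z)) _ 0).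
- by rewrite EFinN oppeK add0e.
- by move=> z _; apply: exponential_pdf_ge0; exact: ltW.
(* The density jumps at 0, so its continuity holds only within [[0, +oo[]; [0 <= x] allows the
   restriction. *)
- apply: (@continuous_subspaceW R^o _ _ [set` `[0, +oo[%R]).
    by apply: subset_itvr; rewrite bnd_simp.
  exact: within_continuous_exponential_pdf.
- rewrite -oppr0; apply: cvgN.
  rewrite (_ : (fun z => expR (- rate * z)) =
               (fun z => expR (- z)) \o (fun z => rate * z)); last first.
    by apply/funext => z /=; rewrite mulNr.
  apply: (@cvg_comp _ _ _ _ _ _ (pinfty_nbhs R)); last exact: cvgr_expR.
  exact: gt0_cvgMry.
- by move=> z _; exact: ex_derive.
- by apply: cvgN; apply/cvg_at_right_filter; exact: cexp.
- move=> z; rewrite in_itv/= andbT => xz; apply: derive1_exponential_pdf.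
  by rewrite in_itv/= andbT (le_lt_trans x_ge0).
Qed.

Lemma uniform_prob_itvoo (R : realType) (a b x y : R) (ab : a < b) :
  a <= x -> x <= y -> y <= b ->
  uniform_prob ab `]x, y[ = ((y - x) / (b - a))%:E.
Proof.
move=> ax xy yb.
rewrite /uniform_prob (eq_integral (fun=> (b - a)^-1%:E)); last first.
  move=> z; rewrite inE/= in_itv/= => /andP[xz zy]; rewrite /uniform_pdf.
  by rewrite (le_trans ax (ltW xz)) (le_trans (ltW zy) yb).
rewrite integral_cst//= lebesgue_measure_itv/= lte_fin.
(* The measure of an empty interval is 0 by cases; there [x = y], so the formula also gives 0. *)
case: ltP => [_|yx]; first by rewrite -EFinD -EFinM mulrC.
by rewrite (le_anti (introT andP (conj xy yx))) subrr mul0r mule0.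
Qed.

Lemma angle_0_2pi_itv (R : realType) (x : R) :
  0 <= angle_0_2pi x < 2 * pi.
Proof.
rewrite /angle_0_2pi; have tpi := @two_pi_gt0 R.
have /andP[] := floor_itv (x / (2 * pi)).
rewrite ler_pdivlMr// ltr_pdivrMr// intrD; lra.
Qed.

Lemma angle_Npi_pi_itv (R : realType) (x : R) :
  - pi < angle_Npi_pi x <= pi.
Proof.
rewrite /angle_Npi_pi; have tpi := @two_pi_gt0 R.
have /andP[] := ceil_itv ((x - pi) / (2 * pi)).
rewrite ltr_pdivlMr// ler_pdivrMr// intrB; lra.
Qed.

(** Both representatives differ from [x] by integer multiples of [2 * pi], and their ranges leave
    only two possible shifts between them. *)
Lemma angle_Npi_piE (R : realType) (x : R) :
  angle_Npi_pi x =
  if angle_0_2pi x <= pi then angle_0_2pi x else angle_0_2pi x - 2 * pi.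
Proof.
have pi0 := pi_gt0 R.
have /andP[y0 y2] := angle_0_2pi_itv x.
have /andP[z0 z1] := angle_Npi_pi_itv x.
have [m zE] : exists m : int, angle_Npi_pi x = angle_0_2pi x + 2 * pi * m%:~R.
  exists (Num.floor (x / (2 * pi)) - Num.ceil ((x - pi) / (2 * pi))).
  rewrite /angle_Npi_pi /angle_0_2pi intrB; ring.
have tpi := @two_pi_gt0 R.
(* The difference of the representatives lies in []- 3 * pi, pi]], hence [m] is 0 or -1. *)
have m_lt1 : (m < 1)%R.
  rewrite -(ltr_int R) -(ltr_pM2l tpi); lra.
have m_gtN2 : (-2 < m)%R.
  rewrite -(ltr_int R) -(ltr_pM2l tpi); lra.
have [m0|mN1] : m = 0 \/ m = -1 by lia.
- rewrite zE m0 mulr0 addr0 in z1 *; by rewrite z1.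
- by rewrite zE mN1 in z0 *; rewrite leNgt ifF; lra.
Qed.

(* The complement of one interval, rather than a union of two lobes, needs no
   special treatment of the overlap at [h = pi]. *)
Lemma abs_angle_Npi_pi_le (R : realType) (x h : R) : 0 <= h <= pi ->
  (`|angle_Npi_pi x| <= h) = ~~ (h < angle_0_2pi x < 2 * pi - h).
Proof.
move=> /andP[h0 hpi]; rewrite angle_Npi_piE.
have /andP[y0 y2] := angle_0_2pi_itv x.
rewrite negb_and -!leNgt ler_norml.
(* As [h <= pi], the bound [h] decides the case up to [pi], and [2 * pi - h] the case beyond it. *)
by case: (leP (angle_0_2pi x) pi) => ypi; apply/andP/orP => [[]|[]]; lra.
Qed.

(** The SNR is [sigma] times a positive coefficient, since [0 < H] keeps the distance positive for
    every [r]; dividing by that coefficient isolates [sigma]. *)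
Lemma sensing_snr_ge (R : realType)
    (P_t lambda_c N_0 alpha kappa_f r H G sigma tau : R) :
  0 < P_t -> 0 < lambda_c -> 0 < N_0 -> 0 < G -> 0 < H ->
  (tau <= sensing_snr P_t lambda_c N_0 alpha kappa_f r H G sigma) =
  (tau * (4 * pi) ^+ 3 * distance3d r H `^ (2 * alpha) * N_0
     * expR (2 * kappa_f * distance3d r H)
     / (P_t * G ^+ 2 * lambda_c ^+ 2) <= sigma).
Proof.
move=> P_t0 lambda0 N_00 G0 H0; rewrite /sensing_snr; set d := distance3d r H.
have d0 : 0 < d.
  by rewrite sqrtr_gt0 ltr_wpDl ?sqr_ge0 ?exprn_gt0.
have K0 : 0 < (4 * pi) ^+ 3 * d `^ (2 * alpha) * N_0.
  by rewrite !mulr_gt0 ?powR_gt0 ?exprn_gt0 ?mulr_gt0 ?pi_gt0.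
have L0 : 0 < P_t * G ^+ 2 * lambda_c ^+ 2.
  by rewrite !mulr_gt0 ?exprn_gt0.
rewrite ler_pdivrMr// -(mulrC sigma) !mulNr expRN -!(mulrA tau).
rewrite ler_pdivlMr ?expR_gt0// mulrAC ler_pdivlMr//.
by congr (_ <= _); ring.
Qed.

Lemma sensing_snr_gain0 (R : realType)
    (P_t lambda_c N_0 alpha kappa_f r H sigma : R) :
  sensing_snr P_t lambda_c N_0 alpha kappa_f r H 0 sigma = 0.
Proof. by rewrite /sensing_snr expr0n/= !(mulr0, mul0r). Qed.

(** The removed interval has length [2 * pi - gamma], so the main lobe keeps mass proportional to
    the beamwidth. *)
Lemma uniform_angle_mainlobe (R : realType) (gamma : R) :
  0 <= gamma -> gamma <= 2 * pi ->
  uniform_angle (~` `]gamma / 2, 2 * pi - gamma / 2[) =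
  (gamma / (2 * pi))%:E.
Proof.
move=> gamma0 gamma2; have tpi := @two_pi_gt0 R.
rewrite /uniform_angle probability_setC//= uniform_prob_itvoo; [|lra..].
rewrite subr0 -EFinB; congr EFin.
by apply: (mulIf (lt0r_neq0 tpi)); rewrite mulrBl !divfK ?lt0r_neq0//; lra.
Qed.

Theorem theorem1 (R : realType)
  (H gamma P_t lambda_c N_0 alpha kappa_f tau_s sigma_bar a b : R)
  (H_gt0 : 0 < H) (gamma_gt0 : 0 < gamma) (gamma_le : gamma <= 2 * pi)
  (P_t_gt0 : 0 < P_t) (lambda_c_gt0 : 0 < lambda_c) (N_0_gt0 : 0 < N_0)
  (alpha_gt0 : 0 < alpha) (kappa_f_gt0 : 0 < kappa_f) (tau_s_gt0 : 0 < tau_s)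
  (sigma_bar_gt0 : 0 < sigma_bar) (a_gt0 : 0 < a) (b_gt0 : 0 < b)
  (r : R) (r_gt0 : 0 < r)
  (disp : measure_display) (T : measurableType disp) (P : probability T R)
  (theta Theta_o sigma : {RV P >-> R}) (los : {RV P >-> bool})
  (angle_law :
     has_law P (fun w => angle_0_2pi (theta w - Theta_o w)) uniform_angle)
  (sigma_law : has_law P sigma (exponential_of_mean sigma_bar))
  (los_law : P [set w | los w] = (los_probability a b r H)%:E)
  (indep : mutually_independent3 P sigma los
     (fun w => angle_0_2pi (theta w - Theta_o w))) :
  let d := distance3d r H in
  P (detection_event H gamma P_t lambda_c N_0 alpha kappa_f tau_s r
       theta Theta_o sigma los) =
  (gamma / (2 * pi) * los_probability a b r H *
   expR (- (tau_s * (4 * pi) ^+ 3 * d `^ (2 * alpha) * N_0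
              * expR (2 * kappa_f * d)
            / (P_t * mainlobe_gain gamma ^+ 2 * lambda_c ^+ 2
                 * sigma_bar))))%:E.
Proof.
move=> d.
have pi0 := pi_gt0 R.
have G0 : 0 < mainlobe_gain gamma by rewrite divr_gt0 ?mulr_gt0.
(* The cross section at which the SNR inside the main lobe equals [tau_s]. *)
set x0 := tau_s * (4 * pi) ^+ 3 * d `^ (2 * alpha) * N_0
            * expR (2 * kappa_f * d)
            / (P_t * mainlobe_gain gamma ^+ 2 * lambda_c ^+ 2).
(* The exponential tail formula holds only from nonnegative points. *)
have x0_ge0 : 0 <= x0.
  apply: divr_ge0; last first.
    exact: ltW (mulr_gt0 (mulr_gt0 P_t_gt0 (exprn_gt0 2 G0))
                         (exprn_gt0 2 lambda_c_gt0)).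
  have four_pi3 : 0 <= (4 * pi : R) ^+ 3.
    by apply: exprn_ge0; apply: mulr_ge0 => //; exact: ltW.
  by rewrite (mulr_ge0 _ (expR_ge0 _))// !(mulr_ge0, powR_ge0, four_pi3)// ltW.
have -> : detection_event H gamma P_t lambda_c N_0 alpha kappa_f tau_s r
    theta Theta_o sigma los =
  sigma @^-1` `[x0, +oo[ `&` los @^-1` [set true] `&`
  (fun w => angle_0_2pi (theta w - Theta_o w)) @^-1`
    (~` `]gamma / 2, 2 * pi - gamma / 2[).
  (* [gamma <= 2 * pi] is what makes the lobe criterion applicable at half the beamwidth. *)
  have half_range : 0 <= gamma / 2 <= pi by apply/andP; split; lra.
  apply/seteqP; split => w; rewrite /detection_event /effective_gain /=
    abs_angle_Npi_pi_le// !in_itv/= andbT.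
  - case: ifPn => [/negP out|_ [_]]; last first.
      by rewrite sensing_snr_gain0 leNgt tau_s_gt0.
    by rewrite sensing_snr_ge// => -[].
  - move=> [[x0w losw] /negP out]; rewrite out; split => //.
    by rewrite sensing_snr_ge.
rewrite indep//; last exact: measurableC.
rewrite angle_law; last exact: measurableC.
rewrite sigma_law// /exponential_of_mean exponential_prob_itvcy ?invr_gt0//.
rewrite los_law uniform_angle_mainlobe//; last exact: ltW.
rewrite -!EFinM; congr EFin.
(* The rate [sigma_bar^-1] multiplying [x0] moves the mean into the denominator of the exponent. *)
rewrite mulrC mulrA mulrAC; congr (_ * _ * expR _).
by rewrite /x0 mulNr (mulrC sigma_bar^-1) -(mulrA _ _^-1) -invfM.
Qed.
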